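(* Let $\vec r(t)$, $t_0<t<t_1$, be a simple curve of class $C^3$ in $\mathbb{R}^3$ with $(\vec r'(t)\wedge\vec r''(t))\cdot\vec r'''(t)\neq0$ for all $t\in(t_0,t_1)$. Fix $t\in(t_0,t_1)$, let $P=\vec r(t)$, and for sufficiently small $\Delta t>0$ let $Q=\vec r(t+\Delta t)$ be the moving point on the curve near $P$ with parameter $\Delta t$. Write $$\overrightarrow{PQ}=\vec r(t+\Delta t)-\vec r(t)=g_1(\Delta t)\vec r'(t)+g_2(\Delta t)\vec r''(t)+g_3(\Delta t)\vec r'''(t),$$ and let $\overrightarrow{PQ}_{12}=g_1\vec r'+g_2\vec r''$, $\overrightarrow{PQ}_{13}=g_1\vec r'+g_3\vec r'''$, $\overrightarrow{PQ}_{23}=g_2\vec r''+g_3\vec r'''$, which are assumed to be nonzero for $\Delta t>0$. Below $\vec r',\vec r'',\vec r'''$ are evaluated at $t$ and $g_i,g_i'$ at $\Delta t$. Then: 1) The rotational speed of $\overrightarrow{PQ}_{12}$ with respect to $\Delta t$ is, for $\Delta t>0$, $$\begin{aligned}&[(g_1\vec r'+g_2\vec r'')^2]^{-3/2}\,\big|g_1^2g_2'(\vec r'\cdot\vec r'')\vec r'+g_2g_2'g_1\vec r''^2\,\vec r'-g_1g_2g_1'(\vec r'\cdot\vec r'')\vec r'-g_2^2g_1'\vec r''^2\,\vec r'\\&\quad+g_1g_1'g_2\vec r'^2\,\vec r''+g_2^2g_1'(\vec r'\cdot\vec r'')\vec r''-g_1^2g_2'\vec r'^2\,\vec r''-g_1g_2g_2'(\vec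 r'\cdot\vec r'')\vec r''\big|,\end{aligned}$$ and, for $\Delta t\to0^+$, $$\frac{|-(\vec r'\cdot\vec r'')\vec r'+\vec r'^2\,\vec r''|}{2|\vec r'|^3}.$$ 2) The rotational speed of $\overrightarrow{PQ}_{13}$ with respect to $\Delta t$ is, for $\Delta t>0$, $$\begin{aligned}&[(g_1\vec r'+g_3\vec r''')^2]^{-3/2}\,\big|g_1^2g_3'(\vec r'\cdot\vec r''')\vec r'+g_3g_3'g_1\vec r'''^2\,\vec r'-g_1g_3g_1'(\vec r'\cdot\vec r''')\vec r'-g_3^2g_1'\vec r'''^2\,\vec r'\\&\quad+g_1g_1'g_3\vec r'^2\,\vec r'''+g_3^2g_1'(\vec r'\cdot\vec r''')\vec r'''-g_1^2g_3'\vec r'^2\,\vec r'''-g_1g_3g_3'(\vec r'\cdot\vec r''')\vec r'''\big|,\end{aligned}$$ and, for $\Delta t\to0^+$, it is $0$. 3) The rotational speed of $\overrightarrow{PQ}_{23}$ with respect to $\Delta t$ is, for $\Delta t>0$, $$\begin{aligned}&[(g_2\vec r''+g_3\vec r''')^2]^{-3/2}\,\big|g_2^2g_3'(\vec r''\cdot\vec r''')\vec r''+g_3g_3'g_2\vec r'''^2\,\vec r''-g_2g_3g_2'(\vec r''\cdot\vec r''')\vec r''-g_3^2g_2'\vec r'''^2\,\vec r''\\&\quad+g_2g_2'g_3\vec r''^2\,\vec r'''+g_3^2g_2'(\vec r''\cdot\vec r''')\vec r'''-g_2^2g_3'\vec r''^2\,\vec r'''-g_2g_3g_3'(\vec r''\cdot\vec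 r''')\vec r'''\big|,\end{aligned}$$ and, for $\Delta t\to0^+$, $$\frac{|-(\vec r''\cdot\vec r''')\vec r''+\vec r''^2\,\vec r'''|}{3|\vec r''|^3}.$$
   Context: $\wedge$ and $\cdot$ are cross and dot product; for a vector $\vec w$, $\vec w^2=\vec w\cdot\vec w$. For a vector function $\vec w(\Delta t)$, nonzero for small $\Delta t>0$, put $\vec e_{\vec w}=\vec w/|\vec w|$ and $\vec e_{\vec w}(0)=\lim_{\Delta t\to0^+}\vec e_{\vec w}(\Delta t)$ (here $\vec e_{\overrightarrow{PQ}_{12}}(0)=\vec e_{\overrightarrow{PQ}_{13}}(0)=\vec r'/|\vec r'|$ and $\vec e_{\overrightarrow{PQ}_{23}}(0)=\vec r''/|\vec r''|$). The rotational speed of $\vec w$ with respect to $\Delta t$ is $\left|\frac{d\vec e_{\vec w}}{d\Delta t}\right|$ for $\Delta t>0$, and for ''$\Delta t\to0^+$'' it is $\left|\lim_{\Delta t\to0^+}\frac{\vec e_{\vec w}(\Delta t)-\vec e_{\vec w}(0)}{\Delta t}\right|$. *)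

(* Defs.v *)
From HB Require Import structures.
From mathcomp Require Export all_boot all_order all_algebra.
From mathcomp Require Export all_classical all_reals all_analysis.

Set Implicit Arguments.
Unset Strict Implicit.
Unset Printing Implicit Defensive.

Import Order.TTheory GRing.Theory Num.Theory.
Import numFieldNormedType.Exports.
Local Open Scope ring_scope.
Local Open Scope classical_set_scope.

Definition dot (R : realType) (u v : 'rV[R]_3) : R :=
  \sum_(i < 3) u ord0 i * v ord0 i.

(* Indices are added modulo 3. *)
Definition cross (R : realType) (u v : 'rV[R]_3) : 'rV[R]_3 :=
  \row_(i < 3) (u ord0 (i + 1) * v ord0 (i + 2) - u ord0 (i + 2) * v ord0 (i + 1)).

(* The library norm on 'rV[R]_3 is the sup norm; it induces the same limits
   and derivatives, but lengths have to be measured with the Euclidean norm. *)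
Definition vlen (R : realType) (u : 'rV[R]_3) : R := Num.sqrt (dot u u).

Definition unitv (R : realType) (u : 'rV[R]_3) : 'rV[R]_3 := (vlen u)^-1 *: u.

Definition classC (R : realType) (n : nat) (a b : R) (r : R -> 'rV[R]_3) : Prop :=
  forall x, a < x < b ->
    (forall k, (k < n)%N -> derivable (derive1n k r) x 1) /\
    {for x, continuous (derive1n n r)}.

Definition is_rotational_speed (R : realType) (w : R -> 'rV[R]_3) (x v : R) : Prop :=
  let e := fun y => unitv (w y) in
  derivable e x 1 /\ vlen (derive1 e x) = v.

(* [e0] is the value at 0 of the unit vector of [w], i.e. its right limit. *)
Definition is_rotational_speed0 (R : realType) (w : R -> 'rV[R]_3)
    (e0 : 'rV[R]_3) (v : R) : Prop :=
  unitv (w x) @[x --> 0^'+] --> e0 /\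
  exists d : 'rV[R]_3,
    (x^-1 *: (unitv (w x) - e0)) @[x --> 0^'+] --> d /\ vlen d = v.

(* Main.v *)
(* Since [r', r'', r'''] is a frame, [g1, g2, g3] are linear functionals of
   [PQ], so they are differentiable and Taylor's formula gives
   [g1 = s + o(s^3)], [g2 = s^2/2 + o(s^3)], [g3 = s^3/6 + o(s^3)].
   For a plane vector [a u + b v] the derivative of its direction is computed
   directly.  At [0], divide the vector by a positive scalar so that it becomes
   [u + beta s v + o(s)]: the right derivative of its direction is then the
   part of [beta v] orthogonal to [u], divided by [|u|].  The three projections
   have [beta = 1/2, 0, 1/3]. *)

Require Import Defs.
From mathcomp Require Import all_boot all_order all_algebra.
From mathcomp Require Import all_classical all_reals all_analysis.
From mathcomp Require Import ring lra.
Import Order.TTheory GRing.Theory Num.Theory.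
Import numFieldNormedType.Exports.
Local Open Scope ring_scope.
Local Open Scope classical_set_scope.

Set Implicit Arguments.
Unset Strict Implicit.

(** * Euclidean algebra of row vectors of length 3 *)

Lemma dotE {R : realType} (u v : 'rV[R]_3) :
  dot u v = u ord0 0 * v ord0 0 + u ord0 1 * v ord0 1 + u ord0 (1 + 1) * v ord0 (1 + 1).
Proof.
rewrite /dot !big_ord_recl big_ord0 addr0 addrA.
by do !congr (_ + _); congr (u _ _ * v _ _); apply/val_inj.
Qed.

Lemma dotC {R : realType} (u v : 'rV[R]_3) : dot u v = dot v u.
Proof. by rewrite !dotE; ring. Qed.

Lemma dotDl {R : realType} (u v w : 'rV[R]_3) : dot (u + v) w = dot u w + dot v w.
Proof. by rewrite !dotE !mxE; ring. Qed.

Lemma dotZl {R : realType} (c : R) (u v : 'rV[R]_3) : dot (c *: u) v = c * dot u v.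
Proof. by rewrite !dotE !mxE; ring. Qed.

Lemma dotNl {R : realType} (u v : 'rV[R]_3) : dot (- u) v = - dot u v.
Proof. by rewrite -scaleN1r dotZl mulN1r. Qed.

Lemma dotDr {R : realType} (u v w : 'rV[R]_3) : dot u (v + w) = dot u v + dot u w.
Proof. by rewrite dotC dotDl !(dotC u). Qed.

Lemma dotZr {R : realType} (c : R) (u v : 'rV[R]_3) : dot u (c *: v) = c * dot u v.
Proof. by rewrite dotC dotZl dotC. Qed.

Lemma dotNr {R : realType} (u v : 'rV[R]_3) : dot u (- v) = - dot u v.
Proof. by rewrite dotC dotNl dotC. Qed.

Lemma dot_ge0 {R : realType} (u : 'rV[R]_3) : 0 <= dot u u.
Proof. by apply: sumr_ge0 => i _; rewrite -expr2 sqr_ge0. Qed.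

Lemma dot_gt0 {R : realType} (u : 'rV[R]_3) : u != 0 -> 0 < dot u u.
Proof.
move=> u0; rewrite lt_neqAle dot_ge0 andbT eq_sym; apply: contra u0 => /eqP h.
apply/eqP/rowP => i; rewrite mxE.
have /psumr_eq0P h' : dot u u = 0 by [].
have /eqP := h' (fun i _ => sqr_ge0 (u ord0 i)) i isT.
by rewrite -expr2 sqrf_eq0 => /eqP.
Qed.

Lemma dot_span {R : realType} (a b : R) (u v : 'rV[R]_3) :
  dot (a *: u + b *: v) (a *: u + b *: v) =
  a ^+ 2 * dot u u + 2 * (a * b) * dot u v + b ^+ 2 * dot v v.
Proof. by rewrite !(dotDl, dotDr, dotZl, dotZr) (dotC v u); ring. Qed.

Lemma vlenZ {R : realType} (c : R) (u : 'rV[R]_3) : vlen (c *: u) = `|c| * vlen u.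
Proof.
by rewrite /vlen dotZl dotZr mulrA -expr2 sqrtrM ?sqr_ge0// sqrtr_sqr.
Qed.

Lemma vlenN {R : realType} (u : 'rV[R]_3) : vlen (- u) = vlen u.
Proof. by rewrite /vlen dotNl dotNr opprK. Qed.

Lemma vlen_gt0 {R : realType} (u : 'rV[R]_3) : u != 0 -> 0 < vlen u.
Proof. by move=> u0; rewrite sqrtr_gt0 dot_gt0. Qed.

Lemma vlen_sqr {R : realType} (u : 'rV[R]_3) : vlen u ^+ 2 = dot u u.
Proof. by rewrite sqr_sqrtr ?dot_ge0. Qed.

Lemma unitvZ {R : realType} (c : R) (u : 'rV[R]_3) : 0 < c -> unitv (c *: u) = unitv u.
Proof.
move=> c0; rewrite /unitv vlenZ gtr0_norm// scalerA invfM mulrAC.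
by rewrite mulVf ?mul1r// gt_eqF.
Qed.

Lemma dot_crossE {R : realType} (u v w : 'rV[R]_3) :
  dot (cross u v) w =
    (u ord0 1 * v ord0 (1 + 1) - u ord0 (1 + 1) * v ord0 1) * w ord0 0
  + (u ord0 (1 + 1) * v ord0 0 - u ord0 0 * v ord0 (1 + 1)) * w ord0 1
  + (u ord0 0 * v ord0 1 - u ord0 1 * v ord0 0) * w ord0 (1 + 1).
Proof.
(* Index arithmetic in ['I_3] is modulo 3; every index is brought to one of the forms [0], [1],
   [1 + 1] used by [dotE]. *)
have e2 : (2 : 'I_3) = 1 + 1 by apply/val_inj.
have e3 : (1 + (1 + 1) : 'I_3) = 0 by apply/val_inj.
by rewrite dotE !mxE !e2 -!addrA !e3 !add0r addr0.
Qed.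

Lemma dot_cross_rot {R : realType} (u v w : 'rV[R]_3) :
  dot (cross v w) u = dot (cross u v) w.
Proof. by rewrite !dot_crossE; ring. Qed.

Lemma dot_crossl {R : realType} (u v : 'rV[R]_3) : dot (cross u v) u = 0.
Proof. by rewrite dot_crossE; ring. Qed.

Lemma dot_crossr {R : realType} (u v : 'rV[R]_3) : dot (cross u v) v = 0.
Proof. by rewrite dot_crossE; ring. Qed.

(** * Derivative of the direction of a moving plane vector *)

Lemma is_derive_mx {R : realType} {m n : nat} (f : R -> 'M[R]_(m, n)) (df : 'M[R]_(m, n))
    (x : R) :
  (forall i j, is_derive x 1 (fun y => f y i j) (df i j)) -> is_derive x 1 f df.
Proof.
move=> h.
have fx : derivable f x 1 by apply/derivable_mxP => i j; apply: ex_derive.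
apply: DeriveDef => //; rewrite derive_mx//; apply/matrixP => i j.
by rewrite mxE derive_val.
Qed.

Lemma is_derive_dot {R : realType} (f : R -> 'rV[R]_3) (c df : 'rV[R]_3) (x : R) :
  is_derive x 1 f df -> is_derive x 1 (fun y => dot c (f y)) (dot c df).
Proof.
move=> [fx <-].
have h i : is_derive x 1 (fun y => c ord0 i * f y ord0 i) (c ord0 i * 'D_1 f x ord0 i).
  rewrite derive_mx// mxE.
  have := (derivable_mxP f x 1).1 fx ord0 i.
  by move=> /derivableP hd; apply: is_deriveZ.
by have := is_derive_sum (h := fun i => fun y => c ord0 i * f y ord0 i) h;
  rewrite fct_sumE.
Qed.

Lemma is_derive_scalel {R : realType} (f : R -> R) (df x : R) (u : 'rV[R]_3) :
  is_derive x 1 f df -> is_derive x 1 (fun y => f y *: u) (df *: u).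
Proof.
move=> hf; apply: is_derive_mx => i j; rewrite mxE mulrC.
rewrite (_ : (fun _ => _) = u i j \*: f); first exact: is_deriveZ.
by apply/funext => y; rewrite mxE mulrC.
Qed.

(** Links the real power in the final formulas to the cube of a square root that differentiation
    produces. *)
Lemma powR_neg32 {R : realType} (x : R) : 0 <= x -> x `^ (- (3 / 2)) = (Num.sqrt x ^+ 3)^-1.
Proof.
move=> x0; rewrite powRN -powR12_sqrt// -powR_mulrn ?powR_ge0// -powRrM.
by congr ((x `^ _)^-1); lra.
Qed.

Lemma is_derive_div_sqrt {R : realType} (f g : R -> R) (df dg x : R) :
  0 < g x -> is_derive x 1 f df -> is_derive x 1 g dg ->
  is_derive x 1 (fun y => f y / Num.sqrt (g y))
    (df / Num.sqrt (g x) - f x * dg / (2 * Num.sqrt (g x) ^+ 3)).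
Proof.
move=> g0 hf hg.
have s0 : Num.sqrt (g x) != 0 by rewrite gt_eqF// sqrtr_gt0.
have hs : is_derive x 1 (Num.sqrt \o g) ((2 * Num.sqrt (g x))^-1 * dg).
  by apply: is_derive1_comp; exact: is_derive1_sqrt.
have hi := is_deriveV (f := Num.sqrt \o g) s0 hs.
have := is_deriveM hf hi.
rewrite (_ : (f * _) = (fun y => f y / Num.sqrt (g y))); last exact/funext.
move=> h; apply: (is_derive_eq h) => /=; rewrite /GRing.scale /=.
by field.
Qed.

(** With [N] the squared length, the coefficient of [u] is [a / sqrt N], whose derivative is
    [(a' N - a N' / 2) / N^(3/2)]. Expanding [N] as a quadratic form in [a] and [b] makes the terms
    in [a^2 a'] cancel; the coefficient of [v] is symmetric. *)
Lemma is_derive_unitv_span {R : realType} (a b : R -> R) (da db s : R) (u v : 'rV[R]_3) :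
  is_derive s 1 a da -> is_derive s 1 b db -> a s *: u + b s *: v != 0 ->
  is_derive s 1 (fun y => unitv (a y *: u + b y *: v))
    ((Num.sqrt (dot (a s *: u + b s *: v) (a s *: u + b s *: v)) ^+ 3)^-1 *:
     ((a s * b s * da * dot u v + b s ^+ 2 * da * dot v v
       - a s ^+ 2 * db * dot u v - a s * b s * db * dot v v) *: u
     + (a s ^+ 2 * db * dot u u + a s * b s * db * dot u v
       - a s * b s * da * dot u u - b s ^+ 2 * da * dot u v) *: v)).
Proof.
move=> ha hb w0.
set N := fun y => dot (a y *: u + b y *: v) (a y *: u + b y *: v).
have N0 : 0 < N s by exact: dot_gt0.
have s0 : Num.sqrt (N s) != 0 by rewrite gt_eqF// sqrtr_gt0.
have hN : is_derive s 1 N (2 * (a s * da * dot u u + (a s * db + b s * da) * dot u v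
                                + b s * db * dot v v)).
  have -> : N = dot u u \*: (a ^+ 2) + (2 * dot u v) \*: (a * b) + dot v v \*: (b ^+ 2).
    apply/funext => y; rewrite /N dot_span.
    rewrite [RHS](_ : _ = dot u u * a y ^+ 2 + 2 * dot u v * (a y * b y)
                          + dot v v * b y ^+ 2); first by ring.
    by rewrite !(fctE, exprfctE).
  apply: is_derive_eq; rewrite /GRing.scale /=; ring.
have -> : (fun y => unitv (a y *: u + b y *: v)) =
    (fun y => (a y / Num.sqrt (N y)) *: u) + (fun y => (b y / Num.sqrt (N y)) *: v).
  by apply/funext => y; rewrite /unitv scalerDr !scalerA /= ![_^-1 * _]mulrC.
have ha' := is_derive_scalel u (is_derive_div_sqrt N0 ha hN).
have hb' := is_derive_scalel v (is_derive_div_sqrt N0 hb hN).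
apply: (is_derive_eq (is_deriveD ha' hb')).
rewrite -/(N s) scalerDr !scalerA.
have NE : Num.sqrt (N s) ^+ 2 = a s ^+ 2 * dot u u + 2 * (a s * b s) * dot u v + b s ^+ 2 * dot v v.
  by rewrite sqr_sqrtr ?ltW// /N dot_span.
(* Over the common denominator [sqrt N ^ 3], the numerator contains only [sqrt N ^ 2], which is the
   quadratic form, so the square root disappears from it. *)
have inv1 : (Num.sqrt (N s))^-1 = (Num.sqrt (N s) ^+ 3)^-1 * Num.sqrt (N s) ^+ 2 by field.
congr (_ *: _ + _ *: _); rewrite inv1 NE; by field.
Qed.

Lemma rotational_speed_span {R : realType} (a b : R -> R) (u v : 'rV[R]_3) (s : R) :
  derivable a s 1 -> derivable b s 1 -> a s *: u + b s *: v != 0 ->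
  is_rotational_speed (fun y => a y *: u + b y *: v) s
    (dot (a s *: u + b s *: v) (a s *: u + b s *: v) `^ (- (3 / 2)) *
     vlen (  (a s ^+ 2 * derive1 b s * dot u v) *: u
           + (b s * derive1 b s * a s * dot v v) *: u
           - (a s * b s * derive1 a s * dot u v) *: u
           - (b s ^+ 2 * derive1 a s * dot v v) *: u
           + (a s * derive1 a s * b s * dot u u) *: v
           + (b s ^+ 2 * derive1 a s * dot u v) *: v
           - (a s ^+ 2 * derive1 b s * dot u u) *: v
           - (a s * b s * derive1 b s * dot u v) *: v)).
Proof.
move=> /derivableP ha /derivableP hb w0.
have he := is_derive_unitv_span ha hb w0.
split; first exact: ex_derive.
rewrite derive1E derive_val vlenZ powR_neg32 ?dot_ge0//.
rewrite ger0_norm; last by rewrite invr_ge0 exprn_ge0// sqrtr_ge0.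
(* The vector in the stated formula is the opposite of the one obtained by differentiation. *)
congr (_ * _); rewrite -vlenN; congr vlen.
rewrite !derive1E; apply/rowP => i; rewrite !mxE; ring.
Qed.

(** * Right limits at 0 and the rotational speed there *)

Lemma cvg_at_right_id {R : realType} (x : R) : y @[y --> x^'+] --> x.
Proof. by apply: cvg_at_right_filter; exact: cvg_id. Qed.

Lemma cvg_right0_mulidl {R : realType} (f : R -> R) (l : R) :
  f x @[x --> 0^'+] --> l -> x * f x @[x --> 0^'+] --> (0 : R).
Proof. by move=> fl; rewrite -[X in _ --> X](mul0r l); apply: cvgM fl; exact: cvg_at_right_id. Qed.

Lemma near_right0_neq0 {R : realType} : \forall x \near (0 : R)^'+, x != 0.
Proof. by near=> x; rewrite gt_eqF. Unshelve. all: by end_near. Qed.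

Lemma near_eq_cvg_to {T : Type} {V : topologicalType} (F : set_system T) {FF : Filter F}
    (f g : T -> V) (l : V) :
  f x @[x --> F] --> l -> (\forall x \near F, f x = g x) -> g x @[x --> F] --> l.
Proof.
move=> fl fg; apply: cvg_trans fl; apply: near_eq_cvg.
by apply: filterS fg => x ->.
Qed.

(* [k] is a positive rescaling making the coefficient of [u] equal to [1 + o(s)];
   it does not affect directions. *)
Lemma rotational_speed0_span {R : realType} (a b k : R -> R) (beta : R) (u v : 'rV[R]_3) :
  u != 0 -> 0 <= beta -> (\forall s \near 0^'+, 0 < k s) ->
  (k s * a s - 1) / s @[s --> 0^'+] --> (0 : R) ->
  k s * b s / s @[s --> 0^'+] --> beta ->
  is_rotational_speed0 (fun s => a s *: u + b s *: v) (unitv u)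
    (beta * vlen (- (dot u v *: u) + dot u u *: v) / vlen u ^+ 3).
Proof.
move=> u0 beta0 k0 ha hb.
set L := vlen u; have L0 : 0 < L by exact: vlen_gt0.
pose p s := k s * a s; pose q s := k s * b s.
have hp : p s @[s --> 0^'+] --> (1 : R).
  rewrite -[X in _ --> X](addr0 1).
  apply: (near_eq_cvg_to (f := fun s => 1 + s * ((k s * a s - 1) / s))).
    by apply: cvgD; [exact: cvg_cst|exact: cvg_right0_mulidl ha].
  near=> s => /=; rewrite /p.
  have s0 : s != 0 by near: s; exact: near_right0_neq0.
  by rewrite [s * _]mulrC divfK// addrC subrK.
have hq : q s @[s --> 0^'+] --> (0 : R).
  apply: (near_eq_cvg_to (cvg_right0_mulidl hb)).
  near=> s => /=.
  have s0 : s != 0 by near: s; exact: near_right0_neq0.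
  by rewrite [s * _]mulrC divfK.
(* [N] is the squared length of the rescaled vector [p u + q v], and [M] below is its length. *)
pose N s := p s ^+ 2 * dot u u + 2 * (p s * q s) * dot u v + q s ^+ 2 * dot v v.
have hN : N s @[s --> 0^'+] --> dot u u.
  have -> : dot u u = 1 * 1 * dot u u + 2 * (1 * 0) * dot u v + 0 * 0 * dot v v by ring.
  apply: cvgD; [apply: cvgD|]; apply: cvgMr_tmp.
  - exact: cvgM.
  - by apply: cvgMl_tmp; exact: cvgM.
  - exact: cvgM.
pose M s := Num.sqrt (N s).
have hM : M s @[s --> 0^'+] --> L.
  by apply: continuous_cvg hN; exact: sqrt_continuous.
have M0 : \forall s \near 0^'+, 0 < M s by exact: cvgr_gt hM _ L0.
(* [T] is [(N - L^2) / s], arranged so that [s] divides only [p - 1] and [q], where the limits are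
   known. *)
pose T s := (p s - 1) / s * (p s + 1) * dot u u + 2 * (p s * (q s / s)) * dot u v
            + q s * (q s / s) * dot v v.
have hT : T s @[s --> 0^'+] --> 2 * beta * dot u v.
  have -> : 2 * beta * dot u v = 0 * (1 + 1) * dot u u + 2 * (1 * beta) * dot u v
    + 0 * beta * dot v v by ring.
  apply: cvgD; [apply: cvgD|]; apply: cvgMr_tmp.
  - by apply: cvgM => //; apply: cvgD => //; exact: cvg_cst.
  - by apply: cvgMl_tmp; exact: cvgM.
  - exact: cvgM.
(* [A] is the coefficient [(p / M - 1 / L) / s] of [u] in the difference quotient: [1 / M - 1 / L]
   is multiplied by the conjugate [M + L], which turns [M - L] into [M^2 - L^2 = s T]. *)
pose A s := (p s - 1) / s / M s - T s / (M s * L * (M s + L)).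
have hA : A s @[s --> 0^'+] --> - (beta * dot u v / L ^+ 3).
  have -> : - (beta * dot u v / L ^+ 3) = 0 / L - 2 * beta * dot u v / (L * L * (L + L)).
    by field; lra.
  apply: cvgB; apply: cvgM => //; apply: cvgV => //; rewrite ?gt_eqF// ?mulr_gt0 ?addr_gt0//.
  apply: cvgM; first exact: cvgMr_tmp.
  by apply: cvgD => //; exact: cvg_cst.
have hB : q s / s / M s @[s --> 0^'+] --> beta / L.
  by apply: cvgM => //; apply: cvgV => //; rewrite gt_eqF.
have hd : (s^-1 *: (unitv (a s *: u + b s *: v) - unitv u)) @[s --> 0^'+] -->
    (- (beta * dot u v / L ^+ 3)) *: u + (beta / L) *: v.
  apply: (near_eq_cvg_to (f := fun s => A s *: u + (q s / s / M s) *: v)).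
    by apply: cvgD; exact: cvgZr_tmp.
  near=> s => /=.
  have s0 : s != 0 by near: s; exact: near_right0_neq0.
  have ks : 0 < k s by near: s.
  have Ms : 0 < M s by near: s.
  have Es : vlen (k s *: (a s *: u + b s *: v)) = M s.
    by rewrite scalerDr !scalerA /vlen dot_span.
  (* The direction is unchanged by the positive factor [k s]. *)
  rewrite -(unitvZ _ ks) /unitv Es -/L.
  have -> : k s *: (a s *: u + b s *: v) = p s *: u + q s *: v.
    by rewrite scalerDr !scalerA.
  have NE : s * T s = M s ^+ 2 - L ^+ 2.
    rewrite sqr_sqrtr; last by rewrite /N -dot_span dot_ge0.
    by rewrite vlen_sqr /N /T; field.
  have TE : T s = (M s ^+ 2 - L ^+ 2) / s by rewrite -NE mulrAC mulfV// mul1r.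
  rewrite /A TE; apply/rowP => i; rewrite !mxE; field; lra.
split.
  (* The limit of the direction follows from that of its difference quotient, multiplied by [s]. *)
  rewrite -[X in _ --> X]addr0 -[X in _ + X](scale0r ((- (beta * dot u v / L ^+ 3)) *: u + (beta / L) *: v)).
  apply: (near_eq_cvg_to (f := fun s =>
      unitv u + s *: (s^-1 *: (unitv (a s *: u + b s *: v) - unitv u)))).
    by apply: cvgD; [exact: cvg_cst|apply: cvgZ hd; exact: cvg_at_right_id].
  near=> s => /=.
  have s0 : s != 0 by near: s; exact: near_right0_neq0.
  by rewrite scalerA mulfV// scale1r addrC subrK.
exists ((- (beta * dot u v / L ^+ 3)) *: u + (beta / L) *: v); split => //.
have -> : (- (beta * dot u v / L ^+ 3)) *: u + (beta / L) *: v =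
   (beta / L ^+ 3) *: (- (dot u v *: u) + dot u u *: v).
  rewrite -vlen_sqr -/L; apply/rowP => i; rewrite !mxE; field; lra.
rewrite vlenZ ger0_norm 1?mulrAC// divr_ge0// exprn_ge0// ltW//.
Unshelve. all: by end_near. Qed.

(** * One-sided Taylor formula of order 3 *)

Lemma is_derive_exprn {R : realType} (n : nat) (x : R) :
  is_derive x 1 (fun y : R => y ^+ n) (n%:R * x ^+ n.-1).
Proof.
rewrite (_ : (fun _ => _) = id ^+ n); last by apply/funext => y; rewrite exprfctE.
by apply: is_derive_eq; rewrite /GRing.scale /= mulr1.
Qed.

Lemma is_derive_cvg_right {R : realType} (f : R -> R) (df x : R) :
  is_derive x 1 f df -> f y @[y --> x^'+] --> f x.
Proof.
move=> hf; apply: cvg_at_right_filter.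
by apply: differentiable_continuous; apply/derivable1_diffP; exact: ex_derive.
Qed.

(** One application of L'Hospital's rule; the factor [n + 1] from the derivative of the denominator
    is harmless because the limit is 0. *)
Lemma cvg_div_exprS {R : realType} (f df : R -> R) (n : nat) (d : R) :
  0 < d -> (forall x, 0 < x < d -> is_derive x 1 f (df x)) ->
  f x @[x --> 0^'+] --> (0 : R) -> df x / x ^+ n @[x --> 0^'+] --> (0 : R) ->
  f x / x ^+ n.+1 @[x --> 0^'+] --> (0 : R).
Proof.
move=> d0 hf f0 hdf.
apply: (lhopital_at_right (dg := fun x => n.+1%:R * x ^+ n) d0 (df := df)) => //.
- by move=> x _; exact: is_derive_exprn.
- have := is_derive_cvg_right (is_derive_exprn n.+1 (0 : R)).
  by rewrite expr0n.
- move=> x; rewrite in_itv/= => /andP[x0 _].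
  by rewrite mulf_neq0 ?pnatr_eq0// expf_neq0// gt_eqF.
- rewrite -[X in _ --> X](mul0r (n.+1%:R^-1)).
  apply: (near_eq_cvg_to (cvgMr_tmp (b := n.+1%:R^-1) hdf)).
  by near=> x; rewrite /= invfM mulrA mulrAC.
Unshelve. all: by end_near. Qed.

(** Peano form of the remainder. The remainders [e0], [e1], [e2] are successive derivatives, so two
    uses of L'Hospital's rule leave [e2 x / x], which tends to 0 by the definition of the derivative
    of [f2] at 0. *)
Lemma taylor3_right {R : realType} (f0 f1 f2 : R -> R) (c d : R) :
  0 < d -> (forall x, 0 <= x < d -> is_derive x 1 f0 (f1 x)) ->
  (forall x, 0 <= x < d -> is_derive x 1 f1 (f2 x)) -> is_derive (0 : R) 1 f2 c ->
  (f0 x - (f0 0 + f1 0 * x + f2 0 / 2 * x ^+ 2 + c / 6 * x ^+ 3)) / x ^+ 3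
    @[x --> 0^'+] --> (0 : R).
Proof.
move=> d0 h0 h1 h2.
pose e2 x := f2 x - (f2 0 + c * x).
pose e1 x := f1 x - (f1 0 + f2 0 * x + c / 2 * x ^+ 2).
pose e0 x := f0 x - (f0 0 + f1 0 * x + f2 0 / 2 * x ^+ 2 + c / 6 * x ^+ 3).
have He1 x : 0 <= x < d -> is_derive x 1 e1 (e2 x).
  move=> xd.
  have -> : e1 = f1 - (cst (f1 0) + f2 0 \*: id + (c / 2) \*: (fun y : R => y ^+ 2)).
    exact/funext.
  have := h1 x xd => ?; have := is_derive_exprn 2 x => ?.
  by apply: is_derive_eq; rewrite /GRing.scale /= /e2; field.
have He0 x : 0 <= x < d -> is_derive x 1 e0 (e1 x).
  move=> xd.
  have -> : e0 = f0 - (cst (f0 0) + f1 0 \*: id + (f2 0 / 2) \*: (fun y : R => y ^+ 2)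
                   + (c / 6) \*: (fun y : R => y ^+ 3)).
    exact/funext.
  have := h0 x xd => ?; have := is_derive_exprn 2 x => ?; have := is_derive_exprn 3 x => ?.
  by apply: is_derive_eq; rewrite /GRing.scale /= /e1; field.
have cvg0 (e de : R -> R) : e 0 = 0 -> is_derive (0 : R) 1 e (de 0) ->
    e x @[x --> 0^'+] --> (0 : R).
  by move=> e00 /is_derive_cvg_right; rewrite e00.
have d0' : (0 : R) <= 0 < d by apply/andP.
have le2 x : 0 < x < d -> 0 <= x < d by move=> /andP[/ltW -> ->].
apply: (@cvg_div_exprS _ e0 e1 2 d) => //.
- by move=> x /le2; exact: He0.
- by apply: (cvg0 _ e1); [rewrite /e0; ring|exact: He0].
apply: (@cvg_div_exprS _ e1 e2 1 d) => //.
- by move=> x /le2; exact: He1.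
- by apply: (cvg0 _ e2); [rewrite /e1; ring|exact: He1].
have [dv2 d2] := h2.
have hq : (h^-1 *: (f2 (h *: 1 + 0) - f2 0)) @[h --> 0^'+] --> c.
  by apply: cvg_dnbhs_at_right; rewrite -d2; exact: dv2.
apply: (near_eq_cvg_to (f := fun x => x^-1 *: (f2 (x *: 1 + 0) - f2 0) - c)).
  rewrite -[X in _ --> X](subrr c).
  by apply: cvgB => //; exact: cvg_cst.
near=> x; have x0 : x != 0 by near: x; exact: near_right0_neq0.
rewrite /e2 addr0 /GRing.scale /= mulr1; field.
Unshelve. all: by end_near. Qed.

(** * Coordinates of the displacement along the curve *)

(** The reciprocal basis: cross products of pairs, divided by the triple product. Cyclic invariance
    of the triple product gives the values 1, orthogonality of a cross product to its factors the
    values 0. *)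
Lemma dual_frame {R : realType} (u v w : 'rV[R]_3) : dot (cross u v) w != 0 ->
  exists c1 c2 c3 : 'rV[R]_3,
    [/\ [/\ dot c1 u = 1, dot c1 v = 0 & dot c1 w = 0],
        [/\ dot c2 u = 0, dot c2 v = 1 & dot c2 w = 0],
        [/\ dot c3 u = 0, dot c3 v = 0 & dot c3 w = 1] &
        forall x y z, let p := x *: u + y *: v + z *: w in
          [/\ dot c1 p = x, dot c2 p = y & dot c3 p = z]].
Proof.
set D := dot _ _ => D0.
exists (D^-1 *: cross v w), (D^-1 *: cross w u), (D^-1 *: cross u v).
set c1 := _ *: cross v w; set c2 := _ *: cross w u; set c3 := _ *: cross u v.
have h1 : [/\ dot c1 u = 1, dot c1 v = 0 & dot c1 w = 0].
  by rewrite !dotZl dot_crossl dot_crossr dot_cross_rot -/D mulr0 mulVf.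
have h2 : [/\ dot c2 u = 0, dot c2 v = 1 & dot c2 w = 0].
  by rewrite !dotZl dot_crossl dot_crossr 2!dot_cross_rot -/D mulr0 mulVf.
have h3 : [/\ dot c3 u = 0, dot c3 v = 0 & dot c3 w = 1].
  by rewrite !dotZl dot_crossl dot_crossr -/D mulr0 mulVf.
split=> // x y z /=; rewrite !dotDr !dotZr.
have [[-> -> ->] [-> -> ->] [-> -> ->]] := And3 h1 h2 h3.
by rewrite !mulr0 !mulr1 !addr0 !add0r.
Qed.

Lemma is_derive_shiftl {R : realType} {V : normedModType R} (f : R -> V) (df : V) (t x : R) :
  is_derive (t + x) 1 f df -> is_derive x 1 (fun y => f (t + y)) df.
Proof.
have e : (fun h : R => h^-1 *: (f (t + (h *: 1 + x)) - f (t + x))) =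
         (fun h : R => h^-1 *: (f (h *: 1 + (t + x)) - f (t + x))).
  by apply/funext => h; rewrite addrCA.
by move=> [df1 df2]; split; rewrite /derivable /derive /= e.
Qed.

Section CurveCoordinate.
Context {R : realType} (t0 t1 : R) (r : R -> 'rV[R]_3).
Hypothesis r_C3 : classC 3 t0 t1 r.
Variables (t delta : R) (c : 'rV[R]_3) (g : R -> R).
Hypotheses (ht : t0 < t < t1) (delta_gt0 : 0 < delta) (delta_le : t + delta <= t1).
Hypothesis gE : forall s, 0 < s < delta -> g s = dot c (r (t + s) - r t).

Let is_derive_coord (k : nat) (s : R) : (k < 3)%N -> 0 <= s < delta ->
  is_derive s 1 (fun y => dot c (derive1n k r (t + y))) (dot c (derive1n k.+1 r (t + s))).
Proof.
move=> k3 sd; apply: is_derive_dot; apply: is_derive_shiftl.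
have ts : t0 < t + s < t1 by move: ht sd delta_le; lra.
have [/(_ k k3) dr _] := r_C3 ts.
by rewrite derive1nS derive1E; exact: derivableP.
Qed.

(** [g] is known only on the open interval, where it equals a smooth expression; derivability is
    local, so it transfers to [g] at interior points. *)
Lemma derivable_coord (s : R) : 0 < s < delta -> derivable g s 1.
Proof.
move=> sd; have s0d : 0 <= s < delta by move: sd; lra.
apply: (@near_eq_derivable _ _ _ (fun y => dot c (r (t + y)) - dot c (r t))).
  have [s0 s1] := andP sd; near=> y.
  have y0 : 0 < y by near: y; exact: lt_nbhsr.
  have y1 : y < delta by near: y; exact: lt_nbhsl.
  by rewrite gE ?y0// dotDr dotNr.
have h := @is_derive_coord 0 s isT s0d.
by apply: (@derivableB _ _ _ (fun y => dot c (r (t + y))) (cst (dot c (r t)))).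
Unshelve. all: by end_near. Qed.

(** Taylor's formula for [dot c (r (t + s))]; its value at 0 is the constant [dot c (r t)]
    subtracted in [g], so no term of order 0 remains. *)
Lemma coord_taylor3 (a1 a2 a3 : R) :
  dot c (derive1n 1 r t) = a1 -> dot c (derive1n 2 r t) = a2 ->
  dot c (derive1n 3 r t) = a3 ->
  (g s - (a1 * s + a2 / 2 * s ^+ 2 + a3 / 6 * s ^+ 3)) / s ^+ 3 @[s --> 0^'+] --> (0 : R).
Proof.
move=> <- <- <-.
have d0 : (0 : R) <= 0 < delta by rewrite delta_gt0 andbT.
have h k k3 s := @is_derive_coord k s k3.
have := taylor3_right delta_gt0 (h 0%N isT) (h 1%N isT) (h 2%N isT 0 d0).
rewrite !addr0 => hT; apply: (near_eq_cvg_to hT).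
near=> s.
have s0 : 0 < s by [].
have s1 : s < delta by near: s; exact: nbhs_right_lt.
have sd : 0 < s < delta by rewrite s0 s1.
rewrite (gE sd) dotDr dotNr /=; congr (_ / _).
by rewrite !opprD !addrA.
Unshelve. all: by end_near. Qed.

End CurveCoordinate.

Unset Implicit Arguments.

Theorem proposition3p5 (R : realType) (t0 t1 : R) (r : R -> 'rV[R]_3)
  (r_simple : forall x y : R, t0 < x < t1 -> t0 < y < t1 -> r x = r y -> x = y)
  (r_C3 : classC 3 t0 t1 r)
  (r_indep : forall x : R, t0 < x < t1 ->
     dot (cross (derive1 r x) (derive1n 2 r x)) (derive1n 3 r x) != 0)
  (t : R) (ht : t0 < t < t1)
  (delta : R) (delta_gt0 : 0 < delta) (delta_le : t + delta <= t1)
  (g1 g2 g3 : R -> R)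
  (PQ_eq : forall s : R, 0 < s < delta ->
     r (t + s) - r t = g1 s *: derive1 r t + g2 s *: derive1n 2 r t + g3 s *: derive1n 3 r t) :
  let r' := derive1 r t in
  let r'' := derive1n 2 r t in
  let r''' := derive1n 3 r t in
  let g1' := derive1 g1 in
  let g2' := derive1 g2 in
  let g3' := derive1 g3 in
  let PQ12 := fun s => g1 s *: r' + g2 s *: r'' in
  let PQ13 := fun s => g1 s *: r' + g3 s *: r''' in
  let PQ23 := fun s => g2 s *: r'' + g3 s *: r''' in
  (forall s : R, 0 < s < delta -> [/\ PQ12 s != 0, PQ13 s != 0 & PQ23 s != 0]) ->
  [/\
    (forall s : R, 0 < s < delta ->
       is_rotational_speed PQ12 s
         (dot (PQ12 s) (PQ12 s) `^ (- (3 / 2)) *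
          vlen (  (g1 s ^+ 2 * g2' s * dot r' r'') *: r'
                + (g2 s * g2' s * g1 s * dot r'' r'') *: r'
                - (g1 s * g2 s * g1' s * dot r' r'') *: r'
                - (g2 s ^+ 2 * g1' s * dot r'' r'') *: r'
                + (g1 s * g1' s * g2 s * dot r' r') *: r''
                + (g2 s ^+ 2 * g1' s * dot r' r'') *: r''
                - (g1 s ^+ 2 * g2' s * dot r' r') *: r''
                - (g1 s * g2 s * g2' s * dot r' r'') *: r''))) /\
    is_rotational_speed0 PQ12 (unitv r')
      (vlen (- (dot r' r'' *: r') + dot r' r' *: r'') / (2 * vlen r' ^+ 3)),
    (forall s : R, 0 < s < delta ->
       is_rotational_speed PQ13 s
         (dot (PQ13 s) (PQ13 s) `^ (- (3 / 2)) *
          vlen (  (g1 s ^+ 2 * g3' s * dot r' r''') *: r'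
                + (g3 s * g3' s * g1 s * dot r''' r''') *: r'
                - (g1 s * g3 s * g1' s * dot r' r''') *: r'
                - (g3 s ^+ 2 * g1' s * dot r''' r''') *: r'
                + (g1 s * g1' s * g3 s * dot r' r') *: r'''
                + (g3 s ^+ 2 * g1' s * dot r' r''') *: r'''
                - (g1 s ^+ 2 * g3' s * dot r' r') *: r'''
                - (g1 s * g3 s * g3' s * dot r' r''') *: r'''))) /\
    is_rotational_speed0 PQ13 (unitv r') 0 &
    (forall s : R, 0 < s < delta ->
       is_rotational_speed PQ23 s
         (dot (PQ23 s) (PQ23 s) `^ (- (3 / 2)) *
          vlen (  (g2 s ^+ 2 * g3' s * dot r'' r''') *: r''
                + (g3 s * g3' s * g2 s * dot r''' r''') *: r''
                - (g2 s * g3 s * g2' s * dot r'' r''') *: r''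
                - (g3 s ^+ 2 * g2' s * dot r''' r''') *: r''
                + (g2 s * g2' s * g3 s * dot r'' r'') *: r'''
                + (g3 s ^+ 2 * g2' s * dot r'' r''') *: r'''
                - (g2 s ^+ 2 * g3' s * dot r'' r'') *: r'''
                - (g2 s * g3 s * g3' s * dot r'' r''') *: r'''))) /\
    is_rotational_speed0 PQ23 (unitv r'')
      (vlen (- (dot r'' r''' *: r'') + dot r'' r'' *: r''') / (3 * vlen r'' ^+ 3)) ].
Proof.
move=> r' r'' r''' g1' g2' g3' PQ12 PQ13 PQ23 PQ_neq0.
have [c1 [c2 [c3 [[c11 c12 c13] [c21 c22 c23] [c31 c32 c33] c_coord]]]] :=
  dual_frame (r_indep t ht).
have g1E s : 0 < s < delta -> g1 s = dot c1 (r (t + s) - r t).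
  by move=> sd; rewrite (PQ_eq s sd); have [-> _ _] := c_coord (g1 s) (g2 s) (g3 s).
have g2E s : 0 < s < delta -> g2 s = dot c2 (r (t + s) - r t).
  by move=> sd; rewrite (PQ_eq s sd); have [_ -> _] := c_coord (g1 s) (g2 s) (g3 s).
have g3E s : 0 < s < delta -> g3 s = dot c3 (r (t + s) - r t).
  by move=> sd; rewrite (PQ_eq s sd); have [_ _ ->] := c_coord (g1 s) (g2 s) (g3 s).
have d1 := derivable_coord r_C3 ht delta_le g1E.
have d2 := derivable_coord r_C3 ht delta_le g2E.
have d3 := derivable_coord r_C3 ht delta_le g3E.
(* Each dual vector annihilates two of the three derivatives, so a single Taylor term survives for
   each coordinate. *)
have e1 : (g1 s - s) / s ^+ 3 @[s --> 0^'+] --> (0 : R).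
  have := coord_taylor3 r_C3 ht delta_gt0 delta_le g1E c11 c12 c13.
  by under eq_fun do rewrite !mul0r mul1r !addr0.
have e2 : (g2 s - s ^+ 2 / 2) / s ^+ 3 @[s --> 0^'+] --> (0 : R).
  have := coord_taylor3 r_C3 ht delta_gt0 delta_le g2E c21 c22 c23.
  by under eq_fun do rewrite !mul0r add0r addr0 mul1r [2^-1 * _]mulrC.
have e3 : (g3 s - s ^+ 3 / 6) / s ^+ 3 @[s --> 0^'+] --> (0 : R).
  have := coord_taylor3 r_C3 ht delta_gt0 delta_le g3E c31 c32 c33.
  by under eq_fun do rewrite !mul0r !add0r mul1r [6^-1 * _]mulrC.
(* A frame vector is nonzero because its dual vector takes the value 1 on it. *)
have neq0 (c u : 'rV[R]_3) : dot c u = 1 -> u != 0.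
  move=> cu; apply: contra_eq_neq cu => ->.
  by rewrite -(scale0r c) dotZr mul0r eq_sym oner_eq0.
have r'0 : r' != 0 by exact: neq0 c11.
have r''0 : r'' != 0 by exact: neq0 c22.
(* The rescalings are the inverses of the leading terms [s] of [g1] and [s^2 / 2] of [g2]. *)
have k1_gt0 : \forall s \near (0 : R)^'+, 0 < s^-1.
  by near=> s; rewrite invr_gt0.
have k2_gt0 : \forall s \near (0 : R)^'+, 0 < 2 / s ^+ 2.
  by near=> s; rewrite divr_gt0// exprn_gt0.
have p1 : (s^-1 * g1 s - 1) / s @[s --> 0^'+] --> (0 : R).
  apply: (near_eq_cvg_to (cvg_right0_mulidl e1)); near=> s.
  by have s0 : s != 0 by [near: s; exact: near_right0_neq0]; field.
have p2 : (2 / s ^+ 2 * g2 s - 1) / s @[s --> 0^'+] --> (0 : R).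
  rewrite -[X in _ --> X](mulr0 2).
  apply: (near_eq_cvg_to (f := fun s => 2 * ((g2 s - s ^+ 2 / 2) / s ^+ 3))).
    exact: cvgMl_tmp.
  near=> s.
  by have s0 : s != 0 by [near: s; exact: near_right0_neq0]; field.
(* This and the next limits give [beta]: [g2 / s^2] tends to 1/2, [g3 / s^2] to 0, and [2 g3 / s^3]
   to 2/6 = 1/3. *)
have q12 : s^-1 * g2 s / s @[s --> 0^'+] --> (2^-1 : R).
  rewrite -[X in _ --> X]add0r.
  apply: (near_eq_cvg_to (f := fun s => s * ((g2 s - s ^+ 2 / 2) / s ^+ 3) + 2^-1)).
    by apply: cvgD; [exact: cvg_right0_mulidl e2|exact: cvg_cst].
  near=> s.
  by have s0 : s != 0 by [near: s; exact: near_right0_neq0]; rewrite /=; field.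
have e3' : (g3 s - s ^+ 3 / 6) / s ^+ 3 + 6^-1 @[s --> 0^'+] --> (0 + 6^-1 : R).
  by apply: cvgD => //; exact: cvg_cst.
have q13 : s^-1 * g3 s / s @[s --> 0^'+] --> (0 : R).
  apply: (near_eq_cvg_to (cvg_right0_mulidl e3')); near=> s.
  by have s0 : s != 0 by [near: s; exact: near_right0_neq0]; rewrite /=; field.
have q23 : 2 / s ^+ 2 * g3 s / s @[s --> 0^'+] --> (3^-1 : R).
  have -> : 3^-1 = 2 * (0 + 6^-1) :> R by field.
  apply: (near_eq_cvg_to (f := fun s => 2 * ((g3 s - s ^+ 3 / 6) / s ^+ 3 + 6^-1))).
    exact: cvgMl_tmp.
  near=> s.
  by have s0 : s != 0 by [near: s; exact: near_right0_neq0]; rewrite /=; field.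
(* Moves the 2 or 3 of the stated denominators to the front, where it is read as [beta]. *)
have divM (x y z : R) : x / (y * z) = y^-1 * x / z by rewrite invfM mulrA [x / y]mulrC.
split; split.
- move=> s sd; have [w0 _ _] := PQ_neq0 s sd.
  exact: rotational_speed_span (d1 s sd) (d2 s sd) w0.
- by rewrite divM; apply: rotational_speed0_span k1_gt0 p1 q12; rewrite ?invr_ge0.
- move=> s sd; have [_ w0 _] := PQ_neq0 s sd.
  exact: rotational_speed_span (d1 s sd) (d3 s sd) w0.
- have := rotational_speed0_span r''' r'0 (lexx _) k1_gt0 p1 q13.
  by rewrite !mul0r.
- move=> s sd; have [_ _ w0] := PQ_neq0 s sd.
  exact: rotational_speed_span (d2 s sd) (d3 s sd) w0.
- by rewrite divM; apply: rotational_speed0_span k2_gt0 p2 q23; rewrite ?invr_ge0.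
Unshelve. all: by end_near. Qed.
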